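(* Let $t\in\mathbb R\setminus\{0\}$. The space $\mathbf H_{2,[*]}^t$, i.e. $\mathbf H_2^t$ endowed with the real symmetric form $[f,g]_{[*]}=\sum_{n=0}^\infty[g_n,f_n]_{[*]}$ for $f(q_t)=\sum_n q_t^nf_n$ and $g(q_t)=\sum_nq_t^ng_n$, is a reproducing kernel Krein space and right $\mathbb H_t$-module with reproducing kernel $$k(q_t,p_t)=\sum_{n=0}^\infty q_t^n(p_t^n)^{[*]}.$$
   Context: For $t\in\mathbb R\setminus\{0\}$, $\mathbb H_t$ is the real algebra (matrix addition and multiplication) of matrices $q_t=\begin{pmatrix}a&tb\\ \overline b&\overline a\end{pmatrix}$, $a,b\in\mathbb C$; $q_t^{[*]}=\begin{pmatrix}a&t\overline b\\ b&\overline a\end{pmatrix}$; $[p,q]_{[*]}={\rm Tr}\,(q^{[*]}p)$ is a real symmetric form on $\mathbb H_t$. $\|q_t\|_E=\sqrt{|a|^2+|t||b|^2}$ and $\|q_t\|_{op}$ is the operator norm of the matrix on $\mathbb C^2$. $\mathbf H_2^t$ is the space of power series $f(q_t)=\sum_{n=0}^\infty q_t^n\alpha_n$, $\alpha_n\in\mathbb H_t$, with $\sum_n\|\alpha_n\|_E^2<\infty$; these converge on $\Omega=\{\|q_t\|_{op}<1\}$, and $\mathbb H_t$ acts by multiplication of the coefficients on the right. A real Krein space is a real vector space with a symmetric bilinear form admitting a direct, orthogonal decomposition $\mathcal V_++\mathcal V_-$ with $(\mathcal V_+,[\cdot,\cdot])$ and $(\mathcal V_-,-[\cdot,\cdot])$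 Hilbert spaces. That $k$ is the reproducing kernel means: for all $p_t\in\Omega$, $b\in\mathbb H_t$, the function $k(\cdot,p_t)b$ belongs to the space, and $[f(\cdot),k(\cdot,p_t)b]_{[*]}=[f(p_t),b]_{[*]}={\rm Tr}\,(b^{[*]}f(p_t))$ for all $f$ in the space. *)

(* Defs.v *)
From HB Require Import structures.
From mathcomp Require Import all_boot all_order all_algebra.
From mathcomp Require Import all_classical all_reals all_analysis.
From mathcomp Require Import complex.

Set Implicit Arguments.
Unset Strict Implicit.
Unset Printing Implicit Defensive.

Import Order.TTheory GRing.Theory Num.Theory.
Import numFieldNormedType.Exports.
Import ComplexField.Normc.

Local Open Scope classical_set_scope.
Local Open Scope complex_scope.
Local Open Scope ring_scope.

Section Ht_matrices.
Variables (R : realType) (t : R).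
Implicit Types A B : 'M[R[i]]_2.

Definition htmx (a b : R[i]) : 'M[R[i]]_2 :=
  \matrix_(i < 2, j < 2)
    if i == 0 then (if j == 0 then a else t%:C * b)
    else (if j == 0 then conjc b else conjc a).

Local Arguments conjc : simpl never.

Definition ht_mx : {pred 'M[R[i]]_2} :=
  fun A => A == htmx (A 0 0) (conjc (A 1 0)).

Lemma htmx00 a b : htmx a b 0 0 = a. Proof. by rewrite mxE. Qed.
Lemma htmx01 a b : htmx a b 0 1 = t%:C * b. Proof. by rewrite mxE. Qed.
Lemma htmx10 a b : htmx a b 1 0 = conjc b. Proof. by rewrite mxE. Qed.
Lemma htmx11 a b : htmx a b 1 1 = conjc a. Proof. by rewrite mxE. Qed.
Definition htmxE := (htmx00, htmx01, htmx10, htmx11).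

Lemma ht_mxP A : reflect (exists a b, A = htmx a b) (A \in ht_mx).
Proof.
apply: (iffP eqP) => [->|[a [b ->]]]; first by do 2!eexists.
by rewrite !htmxE conjcK.
Qed.

Lemma ht_mx_subring : subring_closed (ht_mx).
Proof.
have ord2 (i : 'I_2) : i = 0 \/ i = 1.
  by case: i => [[|[|]]] // i2; [left|right]; apply: val_inj.
have eqmx A B : A 0 0 = B 0 0 -> A 0 1 = B 0 1 -> A 1 0 = B 1 0 ->
    A 1 1 = B 1 1 -> A = B.
  by move=> *; apply/matrixP => i j; case: (ord2 i) => ->; case: (ord2 j) => ->.
have tJ : conjc t%:C = t%:C by rewrite /conjc /= oppr0.
have mulE A B i j : (A * B) i j = A i 0 * B 0 j + A i 1 * B 1 j.
  rewrite mxE big_ord_recl big_ord1; congr (_ + A i _ * B _ j); exact: val_inj.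
split.
- apply/ht_mxP; exists 1, 0.
  by apply: eqmx; rewrite htmxE [LHS]mxE ?rmorph0 ?rmorph1 ?mulr0.
- move=> _ _ /ht_mxP[a [b ->]] /ht_mxP[c [d ->]]; apply/ht_mxP.
  exists (a - c), (b - d).
  by apply: eqmx; rewrite [LHS]mxE [X in _ + X]mxE !htmxE ?rmorphB ?mulrBr.
- move=> _ _ /ht_mxP[a [b ->]] /ht_mxP[c [d ->]]; apply/ht_mxP.
  exists (a * c + t%:C * b * conjc d), (a * d + b * conjc c).
  apply: eqmx; rewrite mulE !htmxE ?rmorphD ?rmorphM //.
  + by rewrite mulrDr -mulrA mulrCA.
  + by rewrite addrC /= conjcK.
  + by rewrite /= conjcK tJ addrC mulrCA mulrA.
Qed.

HB.instance Definition _ :=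
  GRing.isSubringClosed.Build 'M[R[i]]_2 ht_mx ht_mx_subring.

End Ht_matrices.

(* The proof of [t != 0] is a parameter of the type because the Euclidean norm
   below separates points only when [t != 0]. *)
Record Ht (R : realType) (t : R) (t0 : t != 0) := MkHt {
  ht_val :> 'M[R[i]]_2 ;
  ht_valP : ht_val \in ht_mx t }.

Section Ht_algebra.
Variables (R : realType) (t : R) (t0 : t != 0).
Local Notation H := (Ht t0).

HB.instance Definition _ := [isSub of H for @ht_val R t t0].
HB.instance Definition _ := [Choice of H by <:].
HB.instance Definition _ := [SubChoice_isSubNzRing of H by <:].

Lemma mkht_subproof a b : htmx t a b \in ht_mx t.
Proof. by apply/ht_mxP; exists a, b. Qed.

Definition mkht a b : H := MkHt t0 (mkht_subproof a b).

Definition ht_a (q : H) : R[i] := q 0 0.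
Definition ht_b (q : H) : R[i] := conjc (q 1 0).

Lemma ht_eta q : q = mkht (ht_a q) (ht_b q).
Proof. by apply: val_inj => /=; apply/eqP; exact: ht_valP. Qed.

Lemma ht_aK a b : ht_a (mkht a b) = a.
Proof. by rewrite /ht_a htmxE. Qed.

Lemma ht_bK a b : ht_b (mkht a b) = b.
Proof. by rewrite /ht_b htmxE conjcK. Qed.

Lemma ht_ab_inj (p q : H) : ht_a p = ht_a q -> ht_b p = ht_b q -> p = q.
Proof. by move=> pqa pqb; rewrite (ht_eta p) (ht_eta q) pqa pqb. Qed.

Lemma ht_aD (p q : H) : ht_a (p + q) = ht_a p + ht_a q.
Proof. by rewrite /ht_a mxE. Qed.

Lemma ht_bD (p q : H) : ht_b (p + q) = ht_b p + ht_b q.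
Proof. by rewrite /ht_b mxE rmorphD. Qed.

Definition ht_scale (r : R) (q : H) : H := mkht (r%:C * ht_a q) (r%:C * ht_b q).

Lemma ht_scaleE r q : \val (ht_scale r q) = r%:C *: \val q.
Proof.
rewrite [in RHS](ht_eta q) /=; apply/matrixP => i j; rewrite !mxE.
have rJ (z : R[i]) : conjc (r%:C * z) = r%:C * conjc z.
  by rewrite rmorphM/= oppr0.
by case: (i == 0); case: (j == 0); rewrite // mulrCA.
Qed.

Lemma ht_scaleA r s q : ht_scale r (ht_scale s q) = ht_scale (r * s) q.
Proof. by apply: val_inj; rewrite !ht_scaleE scalerA rmorphM. Qed.

Lemma ht_scale1 : left_id 1 ht_scale.
Proof. by move=> q; apply: val_inj; rewrite ht_scaleE rmorph1 scale1r. Qed.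

Lemma ht_scaleDr : right_distributive ht_scale +%R.
Proof.
by move=> r p q; apply: val_inj; rewrite GRing.valD !ht_scaleE GRing.valD scalerDr.
Qed.

Lemma ht_scaleDl q : {morph ht_scale^~ q : r s / r + s}.
Proof.
by move=> r s; apply: val_inj; rewrite GRing.valD !ht_scaleE rmorphD scalerDl.
Qed.

HB.instance Definition _ := GRing.Zmodule_isLmodule.Build R H
  ht_scaleA ht_scale1 ht_scaleDr ht_scaleDl.

Definition ht_norm (q : H) : R :=
  Num.sqrt (normc (ht_a q) ^+ 2 + `|t| * normc (ht_b q) ^+ 2).

Lemma ht_normE q :
  ht_norm q = normc (normc (ht_a q) +i* (Num.sqrt `|t| * normc (ht_b q))).
Proof. by rewrite /= exprMn sqr_sqrtr. Qed.

Lemma ht_normD p q : ht_norm (p + q) <= ht_norm p + ht_norm q.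
Proof.
rewrite [ht_norm p]ht_normE [ht_norm q]ht_normE.
apply: le_trans (le_normcD _ _).
have nc0 (z : R[i]) : 0 <= normc z by case: z => x y; exact: sqrtr_ge0.
rewrite /= -mulrDr exprMn sqr_sqrtr// /ht_norm ht_aD ht_bD ler_wsqrtr//.
by rewrite lerD// ?ler_wpM2l// lerXn2r ?nnegrE ?addr_ge0// le_normcD.
Qed.

Lemma ht_normZ r q : ht_norm (r *: q) = `|r| * ht_norm q.
Proof.
rewrite /ht_norm /GRing.scale/= /ht_scale ht_aK ht_bK !normcM.
have -> : normc r%:C = `|r| by rewrite /= expr0n addr0 sqrtr_sqr.
by rewrite !exprMn (mulrCA `|t|) -mulrDr sqrtrM ?sqr_ge0// sqrtr_sqr normr_id.
Qed.

Lemma ht_norm0_eq0 q : ht_norm q = 0 -> q = 0.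
Proof.
rewrite ht_normE => /eq0_normc/eqP; rewrite eq_complex/= mulf_eq0 sqrtr_eq0.
rewrite normr_le0 (negPf t0)/= => /andP[/eqP/eq0_normc a0 /eqP/eq0_normc b0].
have ht0 : ht_a (0 : H) = 0 /\ ht_b (0 : H) = 0.
  by rewrite /ht_a /ht_b !mxE rmorph0.
by apply: ht_ab_inj; rewrite ?a0 ?b0 ?ht0.1 ?ht0.2.
Qed.

HB.instance Definition _ := Lmodule_isNormed.Build R H
  ht_normD ht_normZ ht_norm0_eq0.

Definition ht_star (q : H) : H := mkht (ht_a q) (conjc (ht_b q)).

Lemma ht_starE a b : ht_star (mkht a b) = mkht a (conjc b).
Proof. by rewrite /ht_star ht_aK ht_bK. Qed.

Definition ht_form (p q : H) : R := complex.Re (\tr (ht_star q * p : H)).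

Lemma ht_form_real p q : (ht_form p q)%:C = \tr (ht_star q * p : H).
Proof.
rewrite /ht_form; set x := _ * _; rewrite (ht_eta x) /mxtrace big_ord_recl.
rewrite big_ord1 /= !mxE /=; case: (ht_a x) => u v.
by rewrite /conjc /real_complex_def; congr (_ +i* _); rewrite /= subrr.
Qed.

End Ht_algebra.

Section Omega.
Variable R : realType.

Definition vnorm2 (v : 'cV[R[i]]_2) : R :=
  Num.sqrt (\sum_(i < 2) normc (v i 0) ^+ 2).

Definition opnorm (A : 'M[R[i]]_2) : R :=
  sup [set vnorm2 (A *m v) | v in [set v | vnorm2 v <= 1]].

Definition Omega (t : R) (t0 : t != 0) := {q : Ht t0 | opnorm q < 1}.

End Omega.

Section Krein.
Variables (R : realType) (U : lmodType R).
Implicit Types (V : set U) (B : U -> U -> R).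

Definition is_subspace V :=
  V 0 /\ forall (r : R) u v, V u -> V v -> V (r *: u + v).

Definition sym_bilinear_on V B :=
  (forall u v, V u -> V v -> B u v = B v u) /\
  (forall (r : R) u v w, V u -> V v -> V w ->
     B (r *: u + v) w = r * B u w + B v w).

Definition complete_on V B :=
  forall u : nat -> U, (forall n, V (u n)) ->
    (forall e : R, 0 < e -> exists N, forall m n, (N <= m)%N -> (N <= n)%N ->
       Num.sqrt (B (u m - u n) (u m - u n)) < e) ->
    exists2 l, V l & Num.sqrt (B (u n - l) (u n - l)) @[n --> \oo] --> (0 : R).

Record is_hilbert V B : Prop := IsHilbert {
  hilbert_subspace : is_subspace V ;
  hilbert_sym_bilinear : sym_bilinear_on V B ;
  hilbert_pos_def : forall u, V u -> u != 0 -> 0 < B u u ;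
  hilbert_complete : complete_on V B }.

Record is_krein_decomposition V B (Vp Vm : set U) : Prop := IsKreinDec {
  krein_sum : V = [set u + v | u in Vp & v in Vm] ;
  krein_direct : Vp `&` Vm = [set 0] ;
  krein_orthogonal : forall u v, Vp u -> Vm v -> B u v = 0 ;
  krein_pos : is_hilbert Vp B ;
  krein_neg : is_hilbert Vm (fun u v => - B u v) }.

Record is_krein V B : Prop := IsKrein {
  krein_subspace : is_subspace V ;
  krein_sym_bilinear : sym_bilinear_on V B ;
  krein_decomposition : exists Vp Vm, is_krein_decomposition V B Vp Vm }.

End Krein.

Record is_right_module (A : pzRingType) (U : zmodType) (V : set U)
    (act : U -> A -> U) : Prop := IsRightModule {
  rmod_0 : V 0 ;
  rmod_B : forall u v, V u -> V v -> V (u - v) ;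
  rmod_act : forall u c, V u -> V (act u c) ;
  rmod_Dl : forall u v c, V u -> V v -> act (u + v) c = act u c + act v c ;
  rmod_Dr : forall u c d, V u -> act u (c + d) = act u c + act u d ;
  rmod_M : forall u c d, V u -> act u (c * d) = act (act u c) d ;
  rmod_1 : forall u, V u -> act u 1 = u }.

Section H2.
Variables (R : realType) (t : R) (t0 : t != 0).
Local Notation H := (Ht t0).
Implicit Types (f g : Omega t0 -> H) (alpha : nat -> H).

Definition square_summable alpha :=
  (\sum_(0 <= n <oo) (`|alpha n| ^+ 2)%:E < +oo)%E.

Definition power_series_of alpha f := forall q : Omega t0,
  series (fun n => sval q ^+ n * alpha n) @ \oo --> f q.

Definition H2 : set (Omega t0 -> H) :=
  [set f | exists2 alpha, square_summable alpha & power_series_of alpha f].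

(* The coefficient sequence of an element of [H2] is unique: the ball contains
   the real multiples [x] of the identity with [`|x| < 1]. *)
Definition coefs f : nat -> H :=
  get [set alpha | square_summable alpha /\ power_series_of alpha f].

Definition H2_form f g : R :=
  limn (series (fun n => ht_form (coefs g n) (coefs f n))).

Definition H2_act f (c : H) : Omega t0 -> H :=
  fun q => limn (series (fun n => sval q ^+ n * (coefs f n * c))).

Definition H2_kernel (q p : Omega t0) : H :=
  limn (series (fun n => sval q ^+ n * ht_star (sval p ^+ n))).

Definition is_reproducing_kernel (V : set (Omega t0 -> H))
    (B : (Omega t0 -> H) -> (Omega t0 -> H) -> R)
    (k : Omega t0 -> Omega t0 -> H) :=
  forall (p : Omega t0) (b : H),
    V (fun q => k q p * b) /\
    forall f, V f -> B f (fun q => k q p * b) = ht_form (f p) b.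

End H2.

(* Main.v *)
(* In the coordinates a = x0 + i x1, b = x2 + i x3 the form on H_t is diagonal of
   signature (2, 2), and flipping the coordinate signs suitably gives a linear
   involution J, isometric for the form, with [p, Jp] = 2 |p|^2. Applied to
   coefficients, J splits H_2 into its +1 and -1 eigenspaces; on these the form is
   plus or minus twice the l^2 norm, so they are Hilbert spaces, and they are
   orthogonal to each other.

   The coefficients of f are determined by its values at the real multiples of 1:
   if c_N is the first nonzero coefficient and |c_n| <= M, then |c_N| <= 2 M x for
   all small x > 0. The first column of q p is q applied to the first column of p,
   whence |q^n p| <= K |q|_op^n |p|; this gives convergence on the unit ball and
   puts the kernel in the space. The reproducing property is
   [f_n, (p^n)^* b] = [p^n f_n, b], summed over n by continuity of [., b]. *)
Require Import Defs.
From HB Require Import structures.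
From mathcomp Require Import all_boot all_order all_algebra.
From mathcomp Require Import all_classical all_reals all_analysis.
From mathcomp Require Import complex.
From mathcomp Require Import ring lra.

Set Implicit Arguments.
Unset Strict Implicit.
Unset Printing Implicit Defensive.

Import Order.TTheory GRing.Theory Num.Theory.
Import numFieldNormedType.Exports.

Local Open Scope classical_set_scope.
Local Open Scope ring_scope.

(** * Real coordinates on [H], the form, and the fundamental symmetry *)

Section Coordinates.
Variables (R : realType) (t : R) (t0 : t != 0).
Local Notation H := (Ht t0).
Implicit Types p q : H.

Definition ht_x0 q : R := complex.Re (ht_a q).
Definition ht_x1 q : R := complex.Im (ht_a q).
Definition ht_x2 q : R := complex.Re (ht_b q).
Definition ht_x3 q : R := complex.Im (ht_b q).
Definition ht_of x0 x1 x2 x3 : H := mkht t0 (Complex x0 x1) (Complex x2 x3).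

Lemma ht_ofE q : q = ht_of (ht_x0 q) (ht_x1 q) (ht_x2 q) (ht_x3 q).
Proof.
rewrite {1}(ht_eta q) /ht_of /ht_x0 /ht_x1 /ht_x2 /ht_x3.
by case: (ht_a q) (ht_b q) => [? ?] [? ?].
Qed.

Lemma ht_ofK x0 x1 x2 x3 : let q := ht_of x0 x1 x2 x3 in
  (ht_x0 q = x0) * (ht_x1 q = x1) * (ht_x2 q = x2) * (ht_x3 q = x3).
Proof. by rewrite /ht_x0 /ht_x1 /ht_x2 /ht_x3 /ht_of ht_aK ht_bK. Qed.

Lemma ht_ofD x0 x1 x2 x3 y0 y1 y2 y3 :
  ht_of x0 x1 x2 x3 + ht_of y0 y1 y2 y3 =
  ht_of (x0 + y0) (x1 + y1) (x2 + y2) (x3 + y3).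
Proof. by apply: ht_ab_inj; rewrite ?ht_aD ?ht_bD !(ht_aK, ht_bK). Qed.

Lemma ht_ofZ r x0 x1 x2 x3 :
  r *: ht_of x0 x1 x2 x3 = ht_of (r * x0) (r * x1) (r * x2) (r * x3).
Proof.
by apply: ht_ab_inj; rewrite /GRing.scale/= /ht_scale !(ht_aK, ht_bK)
  /real_complex_def; simpc; congr Complex; rewrite ?mul0r ?subr0 ?addr0.
Qed.

Lemma ht_ofM x0 x1 x2 x3 y0 y1 y2 y3 :
  ht_of x0 x1 x2 x3 * ht_of y0 y1 y2 y3 =
  ht_of (x0 * y0 - x1 * y1 + t * (x2 * y2 + x3 * y3))
        (x0 * y1 + x1 * y0 + t * (x3 * y2 - x2 * y3))
        (x0 * y2 - x1 * y3 + x2 * y0 + x3 * y1)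
        (x0 * y3 + x1 * y2 + x3 * y0 - x2 * y1).
Proof.
have mulE (A B : 'M[R[i]]_2) i j : (A * B) i j = A i 0 * B 0 j + A i 1 * B 1 j.
  rewrite mxE big_ord_recl big_ord1; congr (_ + A i _ * B _ j); exact: val_inj.
apply: ht_ab_inj; rewrite ?ht_aK ?ht_bK /ht_a /ht_b /= mulE !htmxE /=
  /real_complex_def; simpc => /=; congr Complex; ring.
Qed.

Lemma ht_star_of x0 x1 x2 x3 :
  ht_star (ht_of x0 x1 x2 x3) = ht_of x0 x1 x2 (- x3).
Proof. by rewrite ht_starE. Qed.

Lemma ht_norm_of x0 x1 x2 x3 :
  `|ht_of x0 x1 x2 x3| ^+ 2 =
  x0 ^+ 2 + x1 ^+ 2 + `|t| * (x2 ^+ 2 + x3 ^+ 2).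
Proof.
rewrite -[X in X ^+ 2]/(ht_norm _) /ht_norm ht_aK ht_bK /=.
have nn (x y : R) : 0 <= x ^+ 2 + y ^+ 2 by rewrite addr_ge0 ?sqr_ge0.
by rewrite sqr_sqrtr ?sqr_sqrtr// addr_ge0 ?mulr_ge0 ?sqr_ge0.
Qed.

Lemma ht_form_of x0 x1 x2 x3 y0 y1 y2 y3 :
  ht_form (ht_of x0 x1 x2 x3) (ht_of y0 y1 y2 y3) =
  2 * (x0 * y0 - x1 * y1 + t * (x2 * y2 - x3 * y3)).
Proof.
rewrite /ht_form ht_star_of ht_ofM /mxtrace big_ord_recl big_ord1 /=.
by rewrite !mxE /=; ring.
Qed.

(** Turns identities over [H] into polynomial identities in real coordinates, within reach of
    [ring]. *)
Lemma ht_ind (P : H -> Prop) :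
  (forall x0 x1 x2 x3, P (ht_of x0 x1 x2 x3)) -> forall q, P q.
Proof. by move=> Pof q; rewrite (ht_ofE q). Qed.

Lemma ht_starM p q : ht_star (p * q) = ht_star q * ht_star p.
Proof.
elim/ht_ind: p => x0 x1 x2 x3; elim/ht_ind: q => y0 y1 y2 y3.
by rewrite ht_ofM !ht_star_of ht_ofM; congr ht_of; ring.
Qed.

Lemma ht_starK : involutive (@ht_star R t t0).
Proof. by elim/ht_ind => x0 x1 x2 x3; rewrite !ht_star_of opprK. Qed.

Lemma ht_star_norm q : `|ht_star q| = `|q|.
Proof.
apply/eqP; rewrite -(@eqrXn2 _ 2)//; apply/eqP; elim/ht_ind: q => x0 x1 x2 x3.
by rewrite ht_star_of !ht_norm_of sqrrN.
Qed.

Lemma ht_formC p q : ht_form p q = ht_form q p.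
Proof.
elim/ht_ind: p => x0 x1 x2 x3; elim/ht_ind: q => y0 y1 y2 y3.
by rewrite !ht_form_of; ring.
Qed.

(** Since [ht_star] is an anti-automorphism of order two, left multiplication by [ht_star q] is
    adjoint to left multiplication by [q]. The reproducing property rests on this. *)
Lemma ht_form_starM p q r : ht_form p (ht_star q * r) = ht_form (q * p) r.
Proof. by rewrite /ht_form ht_starM ht_starK mulrA. Qed.

Lemma ht_form_linear q : linear_for *%R (@ht_form R t t0 ^~ q).
Proof.
move=> r p p'; elim/ht_ind: p => x0 x1 x2 x3; elim/ht_ind: q => y0 y1 y2 y3.
elim/ht_ind: p' => z0 z1 z2 z3.
by rewrite ht_ofZ ht_ofD !ht_form_of; ring.
Qed.

Lemma ht_form_linear_r p r q q' :
  ht_form p (r *: q + q') = r * ht_form p q + ht_form p q'.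
Proof. by rewrite ht_formC ht_form_linear 2!(ht_formC _ p). Qed.

Lemma ht_formZl r p q : ht_form (r *: p) q = r * ht_form p q.
Proof.
elim/ht_ind: p => x0 x1 x2 x3; elim/ht_ind: q => y0 y1 y2 y3.
by rewrite ht_ofZ !ht_form_of; ring.
Qed.

Lemma ht_scalerAl r p q : r *: (p * q) = (r *: p) * q.
Proof.
elim/ht_ind: p => x0 x1 x2 x3; elim/ht_ind: q => y0 y1 y2 y3.
by rewrite ht_ofZ !ht_ofM ht_ofZ; congr ht_of; ring.
Qed.

Lemma ht_scalerAr r p q : r *: (p * q) = p * (r *: q).
Proof.
elim/ht_ind: p => x0 x1 x2 x3; elim/ht_ind: q => y0 y1 y2 y3.
by rewrite ht_ofZ !ht_ofM ht_ofZ; congr ht_of; ring.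
Qed.

Lemma ht_mulr_linear q : linear (fun p : H => p * q).
Proof. by move=> r p p'; rewrite mulrDl ht_scalerAl. Qed.

Lemma ht_norm_form p q : `|ht_form p q| <= `|p| ^+ 2 + `|q| ^+ 2.
Proof.
elim/ht_ind: p => x0 x1 x2 x3; elim/ht_ind: q => y0 y1 y2 y3.
rewrite ht_form_of !ht_norm_of.
(* These squares give [2 |x y| <= x^2 + y^2] in each coordinate, with weight 1 on the first two and
   [|t|] on the last two, as in the Euclidean norm. *)
have sq (s x y : R) : 0 <= s -> 0 <= s * (x + y) ^+ 2 /\ 0 <= s * (x - y) ^+ 2.
  by move=> s_ge0; split; rewrite mulr_ge0 ?sqr_ge0.
have [] := sq 1 x0 y0 ler01; have [] := sq 1 x1 y1 ler01.
have [] := sq `|t| x2 y2 (normr_ge0 t); have [] := sq `|t| x3 y3 (normr_ge0 t).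
by rewrite ler_norml; have [_|_] := ger0P t; lra.
Qed.

(* The fundamental symmetry: [p, J p] = 2 |p|^2. *)
Definition ht_J q : H :=
  ht_of (ht_x0 q) (- ht_x1 q) (Num.sg t * ht_x2 q) (- (Num.sg t * ht_x3 q)).

Lemma ht_J_of x0 x1 x2 x3 :
  ht_J (ht_of x0 x1 x2 x3) = ht_of x0 (- x1) (Num.sg t * x2) (- (Num.sg t * x3)).
Proof. by rewrite /ht_J !ht_ofK. Qed.

Lemma ht_J_linear : linear ht_J.
Proof.
move=> r p q; elim/ht_ind: p => x0 x1 x2 x3; elim/ht_ind: q => y0 y1 y2 y3.
by rewrite !(ht_ofZ, ht_ofD, ht_J_of); congr ht_of; ring.
Qed.

HB.instance Definition _ := GRing.isLinear.Build R H H _ ht_J ht_J_linear.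

Lemma ht_JK : involutive ht_J.
Proof.
elim/ht_ind => x0 x1 x2 x3; have sg2 : Num.sg t * Num.sg t = 1.
  by rewrite -expr2 sqr_sg t0.
by rewrite !ht_J_of !opprK !mulrN !opprK !mulrA sg2 !mul1r.
Qed.

Lemma ht_form_J p : ht_form p (ht_J p) = 2 * `|p| ^+ 2.
Proof.
elim/ht_ind: p => x0 x1 x2 x3; rewrite ht_J_of ht_form_of ht_norm_of.
rewrite [in RHS]normrEsg; ring.
Qed.

Lemma ht_form_JJ p q : ht_form (ht_J p) (ht_J q) = ht_form p q.
Proof.
elim/ht_ind: p => x0 x1 x2 x3; elim/ht_ind: q => y0 y1 y2 y3.
have sg2 : Num.sg t ^+ 2 = 1 by rewrite sqr_sg t0.
rewrite !ht_J_of !ht_form_of.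
transitivity (2 * (x0 * y0 - x1 * y1 + t * (Num.sg t ^+ 2 * (x2 * y2 - x3 * y3)))).
  ring.
by rewrite sg2 mul1r.
Qed.

Lemma ht_coord_bound : exists2 C : R, 0 < C & forall q,
  [/\ `|ht_x0 q| <= C * `|q|, `|ht_x1 q| <= C * `|q|,
      `|ht_x2 q| <= C * `|q| & `|ht_x3 q| <= C * `|q|].
Proof.
have s_gt0 : 0 < Num.sqrt `|t| by rewrite sqrtr_gt0 normr_gt0.
have ts : `|t| = Num.sqrt `|t| ^+ 2 by rewrite sqr_sqrtr.
(* The constant 1 serves [x0] and [x1], and the inverse of the root of [|t|] serves [x2] and [x3];
   their sum dominates both. *)
exists (1 + (Num.sqrt `|t|)^-1).
  by rewrite addr_gt0// invr_gt0.
elim/ht_ind => x0 x1 x2 x3; rewrite !ht_ofK.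
set N := `|ht_of _ _ _ _|; have N_ge0 : 0 <= N by rewrite /N normr_ge0.
have N2 : N ^+ 2 = x0 ^+ 2 + x1 ^+ 2 + (`|t| : R) * (x2 ^+ 2 + x3 ^+ 2).
  exact: ht_norm_of.
move: (sqr_ge0 x0) (sqr_ge0 x1) (sqr_ge0 x2) (sqr_ge0 x3) => h0 h1 h2 h3.
have t_ge0 : 0 <= `|t| by [].
have bnd1 (x : R) : x ^+ 2 <= N ^+ 2 -> `|x| <= (1 + (Num.sqrt `|t|)^-1) * N.
  rewrite -real_normK ?num_real// ler_sqr ?nnegrE// => /le_trans; apply.
  by rewrite mulrDl mul1r lerDl mulr_ge0// invr_ge0 ltW.
have bnd2 (x : R) : `|t| * x ^+ 2 <= N ^+ 2 ->
    `|x| <= (1 + (Num.sqrt `|t|)^-1) * N.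
  rewrite [X in X * x ^+ 2]ts -exprMn -real_normK ?num_real// ler_sqr ?nnegrE//.
  rewrite normrM (gtr0_norm s_gt0) -ler_pdivlMl// => /le_trans; apply.
  by rewrite mulrDl mul1r lerDr.
have m2 := mulr_ge0 t_ge0 h2; have m3 := mulr_ge0 t_ge0 h3.
by split; [apply: bnd1|apply: bnd1|apply: bnd2|apply: bnd2]; rewrite N2; lra.
Qed.

End Coordinates.

(** * Consequences of finite dimension: bounded linear maps and completeness *)

Section Topology.
Variables (R : realType) (t : R) (t0 : t != 0).
Local Notation H := (Ht t0).
Implicit Types p q : H.

Lemma ht_basis q :
  q = ht_x0 q *: ht_of t0 1 0 0 0 + ht_x1 q *: ht_of t0 0 1 0 0 +
      ht_x2 q *: ht_of t0 0 0 1 0 + ht_x3 q *: ht_of t0 0 0 0 1.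
Proof.
elim/ht_ind: q => x0 x1 x2 x3.
by rewrite !ht_ofK !ht_ofZ !ht_ofD; congr ht_of; ring.
Qed.

Lemma ht_linear_bounded (W : normedModType R) (f : H -> W) : linear f ->
  exists2 K : R, 0 < K & forall p, `|f p| <= K * `|p|.
Proof.
move=> fl; pose F : {linear H -> W} :=
  HB.pack f (GRing.isLinear.Build _ _ _ _ f fl).
have [C C_gt0 xC] := ht_coord_bound t0.
pose S := `|f (ht_of t0 1 0 0 0)| + `|f (ht_of t0 0 1 0 0)| +
  `|f (ht_of t0 0 0 1 0)| + `|f (ht_of t0 0 0 0 1)|.
(* [S] adds up the norms of the images of the basis; the extra 1 keeps the constant positive when
   [f] vanishes. *)
exists (C * S + 1) => [|p].
  by rewrite ltr_pwDr// mulr_ge0 ?(ltW C_gt0)// /S !addr_ge0.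
have [c0 c1 c2 c3] := xC p.
rewrite mulrDl mul1r; apply: (@le_trans _ _ (C * S * `|p|)); last by rewrite lerDl.
rewrite mulrAC /S {1}[p]ht_basis -[f]/(F : H -> W) !linearD !linearZ /= !mulrDr.
by do 3?[apply: le_trans (ler_normD _ _) _; apply: lerD];
  rewrite normrZ ler_wpM2r.
Qed.

Lemma ht_linear_continuous (W : normedModType R) (f : H -> W) :
  linear f -> continuous f.
Proof.
move=> fl; pose F : {linear H -> W} :=
  HB.pack f (GRing.isLinear.Build _ _ _ _ f fl).
have [K K_gt0 fK] := ht_linear_bounded fl.
apply: (@bounded_linear_continuous _ _ _ F); apply/bounded_funP => r.
exists (K * r) => p pr; apply: le_trans (fK p) _.
by rewrite ler_pM2l.
Qed.

Lemma ht_x_linear : [/\ linear (@ht_x0 R t t0 : H -> R^o),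
  linear (@ht_x1 R t t0 : H -> R^o), linear (@ht_x2 R t t0 : H -> R^o) &
  linear (@ht_x3 R t t0 : H -> R^o)].
Proof.
by split=> r p q; elim/ht_ind: p => ????; elim/ht_ind: q => ????;
  rewrite ht_ofZ ht_ofD !ht_ofK.
Qed.

(** The coordinates are Lipschitz, so a Cauchy filter on [H] has Cauchy images in the complete field
    [R]. Completeness makes absolutely convergent series in [H] converge. *)
Lemma ht_cauchy_cvg (F : set_system H) : ProperFilter F -> cauchy F -> cvg F.
Proof.
move=> FF /cauchyP cF.
have [C C_gt0 xC] := ht_coord_bound t0.
have cvg_coord (x : H -> R^o) : linear x -> (forall p, `|x p| <= C * `|p|) ->
    cvg (x @ F).
  move=> xl xb; pose X : {linear H -> R^o} :=
    HB.pack x (GRing.isLinear.Build _ _ _ _ x xl).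
  apply/cauchy_cvgP/cauchy_exP => e e_gt0.
  have [p pF] := cF (e / C) (divr_gt0 e_gt0 C_gt0).
  exists (x p); rewrite /nbhs/=; apply: filterS pF => q.
  rewrite -!ball_normE /= => pq; rewrite -[x p - x q](linearB X).
  by apply: le_lt_trans (xb _) _; rewrite mulrC -ltr_pdivlMr.
have [l0 l1 l2 l3] := ht_x_linear.
have c0 := cvg_coord _ l0 (fun p => let: And4 h _ _ _ := xC p in h).
have c1 := cvg_coord _ l1 (fun p => let: And4 _ h _ _ := xC p in h).
have c2 := cvg_coord _ l2 (fun p => let: And4 _ _ h _ := xC p in h).
have c3 := cvg_coord _ l3 (fun p => let: And4 _ _ _ h := xC p in h).
suff: cvg (id @ F) by [].
(* The limit in [H] is reassembled from the four coordinate limits. *)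
rewrite (_ : id = fun q : H =>
  ht_x0 q *: ht_of t0 1 0 0 0 + ht_x1 q *: ht_of t0 0 1 0 0 +
  ht_x2 q *: ht_of t0 0 0 1 0 + ht_x3 q *: ht_of t0 0 0 0 1).
  by do 3?apply: is_cvgD; apply: is_cvgZr_tmp.
by apply/funext => q; exact: ht_basis.
Qed.

HB.instance Definition _ := Uniform_isComplete.Build H ht_cauchy_cvg.

End Topology.

(** * Operator norm and growth of powers *)

Section ColumnNorm.
Variables (R : realType) (t : R) (t0 : t != 0).
Local Notation H := (Ht t0).
Implicit Types p q : H.

(* Since the first column of [q * p] is [q] times that of [p], this norm turns the
   operator norm into a bound on left multiplication. *)
Definition ht_cnorm q : R := vnorm2 (col 0 (ht_val q)).

Lemma ht_cnorm_ge0 q : 0 <= ht_cnorm q. Proof. exact: sqrtr_ge0. Qed.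

Lemma ht_cnorm_of x0 x1 x2 x3 : ht_cnorm (ht_of t0 x0 x1 x2 x3) ^+ 2 =
  x0 ^+ 2 + x1 ^+ 2 + (x2 ^+ 2 + x3 ^+ 2).
Proof.
have nn (x y : R) : 0 <= x ^+ 2 + y ^+ 2 by rewrite addr_ge0 ?sqr_ge0.
rewrite /ht_cnorm /vnorm2 big_ord_recl big_ord1 !mxE /=.
by rewrite sqrrN !sqr_sqrtr// ?sqr_sqrtr// addr_ge0.
Qed.

Lemma ht_cnormZ r q : ht_cnorm (r *: q) = `|r| * ht_cnorm q.
Proof.
apply/eqP; rewrite -(@eqrXn2 _ 2) ?mulr_ge0 ?ht_cnorm_ge0//; apply/eqP.
elim/ht_ind: q => x0 x1 x2 x3; rewrite ht_ofZ exprMn real_normK ?num_real//.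
by rewrite !ht_cnorm_of; ring.
Qed.

Lemma ht_cnorm_equiv : exists2 K : R, 0 < K & forall q,
  ht_cnorm q <= K * `|q| /\ `|q| <= K * ht_cnorm q.
Proof.
have [C C_gt0 xC] := ht_coord_bound t0.
have t_ge0 : 0 <= `|t| by [].
have K_gt0 : 0 < 2 * C + (1 + `|t|) by lra.
(* The square of this constant dominates [(2 C)^2], from four coordinates each at most [C |q|], and
   also [1 + |t|], needed in the other direction. *)
exists (2 * C + (1 + `|t|)) => // q.
split; rewrite -ler_sqr ?nnegrE ?ht_cnorm_ge0 ?mulr_ge0 ?ht_cnorm_ge0 ?(ltW K_gt0)//.
  apply: (@le_trans _ _ ((2 * C * `|q|) ^+ 2)); last first.
    rewrite ler_sqr ?nnegrE; last 2 first.
      by rewrite !mulr_ge0// ltW.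
      by rewrite mulr_ge0// ltW.
    by rewrite ler_wpM2r// lerDl addr_ge0.
  have [] := xC q; elim/ht_ind: q => x0 x1 x2 x3.
  rewrite !ht_ofK ht_cnorm_of; set N := C * _.
  have sq (x : R) : `|x| <= N -> x ^+ 2 <= N ^+ 2.
    move=> xN; rewrite -real_normK ?num_real// ler_sqr ?nnegrE//.
    exact: le_trans xN.
  move=> /sq h0 /sq h1 /sq h2 /sq h3.
  by rewrite -mulrA -/N exprMn; lra.
rewrite exprMn; apply: (@le_trans _ _ ((1 + `|t|) * ht_cnorm q ^+ 2)).
  elim/ht_ind: q => x0 x1 x2 x3; rewrite ht_norm_of ht_cnorm_of.
  have := sqr_ge0 x0; have := sqr_ge0 x1; have := sqr_ge0 x2; have := sqr_ge0 x3.
  by nra.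
rewrite ler_wpM2r ?sqr_ge0//.
by nra.
Qed.

Lemma ht_colM q p : ht_val q *m col 0 (ht_val p) = col 0 (ht_val (q * p)).
Proof. by rewrite colE mulmxA -colE. Qed.

Lemma ht_col_surj (v : 'cV[R[i]]_2) : exists q : H, v = col 0 (ht_val q).
Proof.
exists (mkht t0 (v 0 0) (conjc (v 1 0))); apply/matrixP => i j.
rewrite !ord1 !mxE /= conjcK; case: ifPn => [/eqP->//|].
by case: i => [[|[|]]]// i2 _; congr (v _ _); exact: val_inj.
Qed.

Lemma vnorm2_0 : vnorm2 (0 : 'cV[R[i]]_2) = 0.
Proof.
rewrite /vnorm2 big1 ?sqrtr0// => i _.
by rewrite mxE /= expr0n /= addr0 sqrtr0 expr0n.
Qed.

(** A supremum bounds its set only once the set is known to be bounded above. Every vector is the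
    first column of some element of [H], so the bound follows from continuity of left multiplication
    and equivalence of the two norms. *)
Lemma opnorm_ub q : ubound
  [set vnorm2 (ht_val q *m v) | v in [set v | vnorm2 v <= 1]] (opnorm (ht_val q)).
Proof.
apply: sup_upper_bound; split.
  exists (vnorm2 (ht_val q *m 0)); exists 0 => //=.
  by rewrite vnorm2_0 ler01.
have ql : linear (fun p => q * p) by move=> r p p'; rewrite mulrDr ht_scalerAr.
have [M M_gt0 qM] := ht_linear_bounded ql.
have [K K_gt0 cK] := ht_cnorm_equiv.
exists (K * (M * K)) => _ [v /= v1 <-].
have [p pv] := ht_col_surj v; move: v1; rewrite pv ht_colM -!/(ht_cnorm _) => p1.
apply: le_trans (cK _).1 _; rewrite ler_pM2l//.
apply: le_trans (qM _) _; rewrite ler_pM2l//.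
by apply: le_trans (cK _).2 _; rewrite ger_pMr.
Qed.

Lemma opnorm_ge0 q : 0 <= opnorm (ht_val q).
Proof.
apply: (opnorm_ub (q := q)); exists 0 => /=.
  by rewrite vnorm2_0 ler01.
by rewrite mulmx0 vnorm2_0.
Qed.

Lemma ht_cnorm0 : ht_cnorm 0 = 0.
Proof. by rewrite -(scale0r (0 : H)) ht_cnormZ normr0 mul0r. Qed.

Lemma ht_cnormM q p : ht_cnorm (q * p) <= opnorm (ht_val q) * ht_cnorm p.
Proof.
(* A vanishing column norm forces [p = 0]; otherwise [p] is rescaled to column norm 1 and tested in
   the supremum. *)
have [p0|p_neq0] := eqVneq (ht_cnorm p) 0.
  have [K _ /(_ p)[_]] := ht_cnorm_equiv.
  by rewrite p0 mulr0 normr_le0 => /eqP->; rewrite !mulr0 ht_cnorm0.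
have p_gt0 : 0 < ht_cnorm p by rewrite lt_neqAle eq_sym p_neq0 ht_cnorm_ge0.
rewrite -ler_pdivrMr// mulrC -[X in X * _]ger0_norm ?invr_ge0 ?ht_cnorm_ge0//.
rewrite -ht_cnormZ ht_scalerAr; apply: opnorm_ub.
exists (col 0 (ht_val ((ht_cnorm p)^-1 *: p))); last by rewrite ht_colM.
change (ht_cnorm ((ht_cnorm p)^-1 *: p) <= 1).
by rewrite ht_cnormZ ger0_norm ?invr_ge0 ?ht_cnorm_ge0// mulVf.
Qed.

(** The column norm iterates without loss, so the equivalence constant is paid only twice, on
    entering and on leaving it, whatever [n] is. *)
Lemma ht_exp_bound q : exists2 K : R, 0 < K & forall n p,
  `|q ^+ n * p| <= K * opnorm (ht_val q) ^+ n * `|p|.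
Proof.
have [K K_gt0 cK] := ht_cnorm_equiv; exists (K * K) => [|n p].
  exact: mulr_gt0.
apply: le_trans (cK _).2 _; rewrite -!mulrA ler_pM2l//.
apply: (@le_trans _ _ (opnorm (ht_val q) ^+ n * ht_cnorm p)).
  elim: n => [|n ih]; first by rewrite !expr0 !mul1r.
  rewrite !exprS -!mulrA; apply: le_trans (ht_cnormM _ _) _.
  by rewrite ler_wpM2l ?opnorm_ge0.
by rewrite mulrCA ler_wpM2l ?exprn_ge0 ?opnorm_ge0// (cK _).1.
Qed.

Lemma opnorm_scale (r : R) : opnorm (ht_val (r *: (1 : H))) <= `|r|.
Proof.
apply: ge_sup.
  exists (vnorm2 (ht_val (r *: (1 : H)) *m 0)); exists 0 => //=.
  by rewrite vnorm2_0 ler01.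
move=> _ [v v1 <-]; have [p pv] := ht_col_surj v.
move: v1; rewrite pv ht_colM => p1; have {}p1 : ht_cnorm p <= 1 by [].
rewrite -/(ht_cnorm _) -ht_scalerAl mul1r ht_cnormZ.
by rewrite ler_piMr.
Qed.

End ColumnNorm.

(** * Square-summable coefficient sequences *)

Lemma bounded_series_cvg (R : realType) (u : R ^nat) (M : R) :
  (forall n, 0 <= u n) -> (forall N, series u N <= M) -> cvgn (series u).
Proof.
move=> u_ge0 uM; apply: nondecreasing_is_cvgn; first exact: nondecreasing_series.
by exists M => _ [N _ <-].
Qed.

Section SquareSummable.
Variables (R : realType) (t : R) (t0 : t != 0).
Local Notation H := (Ht t0).
Implicit Types (alpha beta : nat -> H).

(** Passes from the extended-real sum to real partial sums, where the estimates below take place. *)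
Lemma square_summableP alpha : square_summable alpha <->
  exists M : R, forall N, series (fun n => `|alpha n| ^+ 2) N <= M.
Proof.
have sq_ge0 n : (0 <= (`|alpha n| ^+ 2)%:E)%E by rewrite lee_fin sqr_ge0.
rewrite /square_summable; split=> [sfin|[M sM]].
  set S := (X in (X < _)%E) in sfin.
  have S_ge0 : (0 <= S)%E by apply: nneseries_ge0.
  exists (fine S) => N; rewrite -lee_fin fineK ?ge0_fin_numE// /series /= -sumEFin.
  exact: nneseries_lim_ge.
apply: (@le_lt_trans _ _ M%:E); last exact: ltry.
apply: lime_le; first exact: is_cvg_nneseries.
by apply: nearW => N; rewrite sumEFin lee_fin; exact: sM.
Qed.

Lemma square_summable_cvg alpha : square_summable alpha ->
  cvgn (series (fun n => `|alpha n| ^+ 2)).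
Proof.
by move=> /square_summableP[M]; apply: bounded_series_cvg => n; exact: sqr_ge0.
Qed.

Lemma square_summable_bounded alpha : square_summable alpha ->
  exists2 M : R, 0 < M & forall n, `|alpha n| <= M.
Proof.
move=> /square_summableP[M sM]; have sq_ge0 n : 0 <= `|alpha n| ^+ 2 by exact: sqr_ge0.
have M_ge0 : 0 <= M by have := sM 0%N; rewrite /series /= big_geq.
(* For nonnegative [x], [x^2 <= M] implies [x <= 1 + M], and this bound is positive even when
   [M = 0]. *)
exists (1 + M) => [|n]; first lra.
have : `|alpha n| ^+ 2 <= M.
  apply: le_trans (sM n.+1); rewrite /series /= big_nat_recr//= lerDr.
  by rewrite sumr_ge0.
by have := normr_ge0 (alpha n); nra.
Qed.

Lemma square_summable_le alpha beta (C : R) : 0 <= C ->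
  (forall n, `|beta n| <= C * `|alpha n|) ->
  square_summable alpha -> square_summable beta.
Proof.
move=> C_ge0 bC /square_summableP[M sM]; apply/square_summableP.
exists (C ^+ 2 * M) => N; apply: le_trans (ler_wpM2l (sqr_ge0 C) (sM N)).
rewrite /series /= mulr_sumr; apply: ler_sum => n _.
by rewrite -exprMn ler_sqr ?nnegrE ?mulr_ge0.
Qed.

Lemma square_summable_linear (f : H -> H) alpha : linear f ->
  square_summable alpha -> square_summable (f \o alpha).
Proof.
move=> /ht_linear_bounded[K K_gt0 fK]; apply: (square_summable_le (ltW K_gt0)).
by move=> n; exact: fK.
Qed.

Lemma square_summable_lin (r : R) alpha beta : square_summable alpha ->
  square_summable beta -> square_summable (fun n => r *: alpha n + beta n).
Proof.
move=> /square_summableP[M sM] /square_summableP[N sN]; apply/square_summableP.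
(* The constant comes from [(x + y)^2 <= 2 x^2 + 2 y^2]. *)
exists (2 * (r ^+ 2 * M) + 2 * N) => k.
have := lerD (ler_wpM2l (ler0n R 2) (ler_wpM2l (sqr_ge0 r) (sM k)))
  (ler_wpM2l (ler0n R 2) (sN k)).
apply: le_trans; rewrite /series /= !mulr_sumr -big_split /=.
apply: ler_sum => n _; rewrite -[r ^+ 2]real_normK ?num_real// -exprMn -normrZ.
have := ler_normD (r *: alpha n) (beta n); have := sqr_ge0 (`|r *: alpha n| - `|beta n|).
have := normr_ge0 (r *: alpha n); have := normr_ge0 (beta n).
have := normr_ge0 (r *: alpha n + beta n).
set x := `|r *: _|; set y := `|beta _|; set z := `|_ + _|; nra.
Qed.

Lemma square_summable0 : square_summable (fun=> 0 : H).
Proof.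
apply/square_summableP; exists 0 => N.
by rewrite /series /= big1// => n _; rewrite normr0 expr0n.
Qed.

Lemma ht_form_series_cvg alpha beta : square_summable alpha ->
  square_summable beta -> cvgn (series (fun n => ht_form (beta n) (alpha n))).
Proof.
move=> /square_summableP[M sM] /square_summableP[N sN].
apply: (@normed_cvg _ R^o); apply: (@bounded_series_cvg _ _ (N + M)) => [n|k].
  exact: normr_ge0.
apply: le_trans (lerD (sN k) (sM k)); rewrite /series /= -big_split /=.
by apply: ler_sum => n _; exact: ht_norm_form.
Qed.

End SquareSummable.

(** * Power series on the ball and uniqueness of coefficients *)

Section PowerSeries.
Variables (R : realType) (t : R) (t0 : t != 0).
Local Notation H := (Ht t0).
Implicit Types (alpha beta : nat -> H) (f g : Omega t0 -> H) (q : Omega t0).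

Lemma power_series_cvg alpha q : square_summable alpha ->
  cvgn (series (fun n => sval q ^+ n * alpha n)).
Proof.
move=> /square_summable_bounded[M M_gt0 aM].
have [K K_gt0 qK] := ht_exp_bound (sval q); apply: normed_cvg.
apply: (@series_le_cvg _ _ (geometric (K * M) (opnorm (ht_val (sval q))))) => [n|n|n|].
- exact: normr_ge0.
- by rewrite /geometric /= !mulr_ge0 ?exprn_ge0 ?opnorm_ge0 ?ltW.
- apply: le_trans (qK _ _) _; rewrite /geometric /= mulrAC ler_wpM2r//.
    by rewrite exprn_ge0// opnorm_ge0.
  by rewrite ler_pM2l.
- apply: is_cvg_geometric_series; rewrite ger0_norm ?opnorm_ge0//.
  exact: (svalP q).
Qed.

Lemma power_series_ex alpha : square_summable alpha ->
  exists f, power_series_of alpha f.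
Proof.
move=> sa; exists (fun q => limn (series (fun n => sval q ^+ n * alpha n))) => q.
exact: power_series_cvg.
Qed.

Lemma power_series_lin (r : R) alpha beta f g : power_series_of alpha f ->
  power_series_of beta g ->
  power_series_of (fun n => r *: alpha n + beta n) (r *: f + g).
Proof.
move=> af bg q; rewrite /series /=.
under eq_fun do under eq_bigr do rewrite mulrDr -ht_scalerAr.
under eq_fun do rewrite big_split -scaler_sumr.
by apply: cvgD (bg q); apply: cvgZ (af q); exact: cvg_cst.
Qed.

Lemma power_series_mulr alpha f (c : H) : power_series_of alpha f ->
  power_series_of (fun n => alpha n * c) (fun q => f q * c).
Proof.
move=> af q.
rewrite /series /=; under eq_fun do under eq_bigr do rewrite mulrA.
under eq_fun do rewrite -mulr_suml.
exact: (cvg_comp _ _ (af q) (@ht_linear_continuous _ _ t0 _ _ (ht_mulr_linear c) (f q))).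
Qed.

Lemma power_series_eq0 alpha : square_summable alpha ->
  power_series_of alpha (fun=> 0) -> forall n, alpha n = 0.
Proof.
move=> /square_summable_bounded[M M_gt0 aM] a0.
elim/ltn_ind => N ih; apply/eqP; rewrite -normr_le0.
apply/ler_addgt0Pl => e e_gt0; rewrite addr0.
(* The bound [1/2] puts [x] times the identity in the ball and gives [1 / (1 - x) <= 2]; the bound
   [e / (2 M)] brings the tail [2 M x] below [e]. *)
pose x := Num.min (2^-1) (e / (2 * M)).
have x_gt0 : 0 < x by rewrite lt_min invr_gt0 divr_gt0 ?mulr_gt0// ltr0n.
have x_half : x <= 2^-1 by rewrite ge_min lexx.
have xe : x * (2 * M) <= e.
  by rewrite -ler_pdivlMr ?mulr_gt0// ge_min lexx orbT.
have x1 : opnorm (ht_val (x *: (1 : H))) < 1.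
  apply: le_lt_trans (opnorm_scale _ _) _.
  by rewrite gtr0_norm//; lra.
have expx n p : (x *: (1 : H)) ^+ n * p = x ^+ n *: p.
  elim: n => [|n IHn]; first by rewrite !expr0 mul1r scale1r.
  by rewrite !exprS -mulrA IHn -ht_scalerAl mul1r scalerA.
have tail K : series (geometric (M * x) x) K <= 2 * M * x.
  rewrite geometric_seriesE ?lt_eqF//=; last lra.
  have xK : 0 <= x ^+ K by rewrite exprn_ge0 ?ltW.
  rewrite ler_pdivrMr; last lra.
  have Mx : 0 < M * x by exact: mulr_gt0.
  nra.
(* Here [x] is fixed and [d] measures how far a partial sum is from its limit 0. Letting [d] tend to
   0 first allows the factor [x^N] to be cancelled. *)
suff bnd d : 0 < d -> x ^+ N * `|alpha N| <= d + x ^+ N * (2 * M * x).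
  have : x ^+ N * `|alpha N| <= x ^+ N * (2 * M * x).
    apply/ler_addgt0Pl => d d_gt0; exact: bnd.
  rewrite ler_pM2l ?exprn_gt0// => /le_trans; apply.
  by rewrite mulrC.
move=> d_gt0.
have /cvgrPdist_lt/(_ d d_gt0)[K _ sK] :=
  a0 (exist (fun q : H => is_true (opnorm (ht_val q) < 1)) _ x1).
(* This index is beyond [K] and large enough for the partial sum to contain the term of degree [N];
   the lower terms vanish by induction. *)
have := sK (N.+1 + K)%N; rewrite /= leq_addl => /(_ isT).
rewrite sub0r normrN /series /= => sd.
have sumE : \sum_(0 <= n < N.+1 + K) (x *: (1 : H)) ^+ n * alpha n =
    x ^+ N *: alpha N + \sum_(0 <= k < K) x ^+ (N.+1 + k) *: alpha (N.+1 + k)%N.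
  rewrite (big_cat_nat (n := N.+1)) ?leq_addr//= big_nat_recr//=.
  rewrite big_nat_cond big1 ?add0r ?expx; last first.
    by move=> n /andP[/andP[_ /ih ->] _]; rewrite mulr0.
  congr (_ + _); rewrite -{1}[N.+1]add0n big_addn addKn.
  by apply: eq_bigr => k _; rewrite expx addnC.
rewrite -[x ^+ N]gtr0_norm ?exprn_gt0// -normrZ gtr0_norm ?exprn_gt0//.
rewrite -[x ^+ N *: alpha N](addrK
  (\sum_(0 <= k < K) x ^+ (N.+1 + k) *: alpha (N.+1 + k)%N)) -sumE.
apply: le_trans (ler_normB _ _) _; apply: lerD; first exact: ltW.
apply: le_trans (ler_norm_sum _ _ _) _.
apply: le_trans (ler_wpM2l (exprn_ge0 N (ltW x_gt0)) (tail K)).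
rewrite /series /= mulr_sumr; apply: ler_sum => k _.
rewrite normrZ gtr0_norm ?exprn_gt0// /geometric /= exprD exprSr -!mulrA.
rewrite ler_pM2l ?exprn_gt0// [leRHS]mulrCA ler_pM2l// mulrC.
by rewrite ler_pM2r ?exprn_gt0.
Qed.

Lemma power_series_inj alpha beta f : square_summable alpha ->
  square_summable beta -> power_series_of alpha f -> power_series_of beta f ->
  alpha = beta.
Proof.
move=> sa sb af bf; apply/funext => n; apply/eqP; rewrite -subr_eq0; apply/eqP.
rewrite addrC -[X in X + _]scaleN1r.
apply: (power_series_eq0 (alpha := fun n => -1 *: beta n + alpha n)).
  exact: square_summable_lin.
by have := power_series_lin (r := -1) bf af; rewrite scaleN1r addNr.
Qed.

(** [get] returns some representing sequence, and uniqueness identifies it with the given one. *)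
Lemma coefsE alpha f : square_summable alpha -> power_series_of alpha f ->
  coefs f = alpha.
Proof.
move=> sa af; rewrite /coefs; case: xgetP => [beta _ [sb bf]|/(_ alpha)[]//].
exact: power_series_inj bf af.
Qed.

Lemma H2_coefs f : H2 f -> square_summable (coefs f) /\ power_series_of (coefs f) f.
Proof. by move=> [alpha sa af]; rewrite (coefsE sa af). Qed.

Lemma H2_lin (r : R) f g : H2 f -> H2 g -> H2 (r *: f + g).
Proof.
move=> [a sa af] [b sb bg]; exists (fun n => r *: a n + b n).
  exact: square_summable_lin.
exact: power_series_lin.
Qed.

Lemma coefs_lin (r : R) f g : H2 f -> H2 g ->
  coefs (r *: f + g) = fun n => r *: coefs f n + coefs g n.
Proof.
move=> /H2_coefs[sf pf] /H2_coefs[sg pg]; apply: coefsE.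
  exact: square_summable_lin.
exact: power_series_lin.
Qed.

Lemma power_series0 : power_series_of (fun=> 0) (0 : Omega t0 -> H).
Proof.
move=> q; rewrite /series /=; under eq_fun do under eq_bigr do rewrite mulr0.
by under eq_fun do rewrite big1_eq; exact: cvg_cst.
Qed.

Lemma H2_0 : H2 (0 : Omega t0 -> H).
Proof. by exists (fun=> 0); [exact: square_summable0|exact: power_series0]. Qed.

Lemma coefs0 : coefs (0 : Omega t0 -> H) = fun=> 0.
Proof. by apply: coefsE; [exact: square_summable0|exact: power_series0]. Qed.

(** The powers of [q] stand on the left of the coefficients, so [c] factors out of each partial sum
    on the right and, by continuity, out of the limit. The module laws thus become pointwise ring
    laws. *)
Lemma H2_actE f (c : H) : H2 f -> H2_act f c = fun q => f q * c.
Proof.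
move=> /H2_coefs[sf pf]; apply/funext => q.
by apply: cvg_lim => //; exact: power_series_mulr.
Qed.

Lemma H2_act_mem f (c : H) : H2 f -> H2 (H2_act f c).
Proof.
move=> Hf; rewrite H2_actE//; case: Hf => a sa af.
exists (fun n => a n * c); last exact: power_series_mulr.
exact: square_summable_linear (ht_mulr_linear c) sa.
Qed.

End PowerSeries.

(** * The form on [H2] and its Krein decomposition *)

Section Krein.
Variables (R : realType) (t : R) (t0 : t != 0).
Local Notation H := (Ht t0).
Implicit Types (alpha beta : nat -> H) (f g : Omega t0 -> H) (q p : Omega t0).

Lemma H2_form_cvg f g (fn gn : nat -> H) :
  square_summable fn -> power_series_of fn f ->
  square_summable gn -> power_series_of gn g ->
  series (fun n => ht_form (gn n) (fn n)) @ \oo --> H2_form f g.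
Proof.
move=> sf pf sg pg; rewrite /H2_form (coefsE sf pf) (coefsE sg pg).
exact: ht_form_series_cvg.
Qed.

Lemma H2_formC f g : H2_form f g = H2_form g f.
Proof. by congr (limn (series _)); apply/funext => n; exact: ht_formC. Qed.

Lemma H2_form_linear (r : R) f g h : H2 f -> H2 g -> H2 h ->
  H2_form (r *: f + g) h = r * H2_form f h + H2_form g h.
Proof.
move=> Hf Hg Hh; rewrite /H2_form coefs_lin//.
have [sf pf] := H2_coefs Hf; have [sg pg] := H2_coefs Hg.
have [sh ph] := H2_coefs Hh.
have S N : series (fun n => ht_form (coefs h n) (r *: coefs f n + coefs g n)) N =
    r * series (fun n => ht_form (coefs h n) (coefs f n)) N +
    series (fun n => ht_form (coefs h n) (coefs g n)) N.
  rewrite /series mulr_sumr -big_split.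
  by apply: eq_bigr => n _; exact: ht_form_linear_r.
rewrite [LHS](congr1 (fun u : R ^nat => limn u) (funext S)).
apply: cvg_lim => //.
apply: cvgD (H2_form_cvg sg pg sh ph).
apply: cvgM (H2_form_cvg sf pf sh ph).
exact: cvg_cst.
Qed.

Lemma H2_sym_bilinear : sym_bilinear_on (@H2 R t t0) (@H2_form R t t0).
Proof.
by split=> [u v _ _|r u v w]; [exact: H2_formC|exact: H2_form_linear].
Qed.

Lemma H2B f g : H2 f -> H2 g -> H2 (f - g).
Proof. by move=> Hf Hg; rewrite addrC -scaleN1r; exact: H2_lin. Qed.

Lemma coefsB f g : H2 f -> H2 g -> coefs (f - g) = fun n => coefs f n - coefs g n.
Proof.
move=> Hf Hg; rewrite addrC -scaleN1r coefs_lin//; apply/funext => n.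
by rewrite scaleN1r addrC.
Qed.

Lemma coefs_eq0 f : H2 f -> (forall n, coefs f n = 0) -> f = 0.
Proof.
move=> Hf c0; have [_ pf] := H2_coefs Hf.
have p0 := @power_series0 R t t0; apply/funext => q.
have -> : f q = limn (series (fun n => sval q ^+ n * coefs f n)).
  by apply/esym/cvg_lim => //; exact: pf.
apply: cvg_lim => //; rewrite (_ : coefs f = fun=> 0); first exact: p0.
exact/funext.
Qed.

(** The values [s = 1] and [s = -1] give the two summands; the parameter lets one argument treat
    both. *)
Definition H2_eig (s : R) : set (Omega t0 -> H) :=
  [set f | H2 f /\ forall n, ht_J (coefs f n) = s *: coefs f n].

Lemma H2_eig_subspace s : is_subspace (H2_eig s).
Proof.
split=> [|r f g [Hf ef] [Hg eg]].
  by split=> [|n]; rewrite ?coefs0 ?linear0 ?scaler0//; exact: H2_0.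
split=> [|n]; first exact: H2_lin.
by rewrite coefs_lin// ht_J_linear ef eg scalerDr scalerA mulrC -scalerA.
Qed.

Lemma H2_eig_B s f g : H2_eig s f -> H2_eig s g -> H2_eig s (f - g).
Proof.
move=> ef eg; rewrite addrC -scaleN1r.
exact: (H2_eig_subspace s).2.
Qed.

(** For each coefficient [c], [s [c, c] = [c, J c] = 2 |c|^2]. *)
Lemma H2_eig_form s f : s * s = 1 -> H2_eig s f ->
  s * H2_form f f = 2 * limn (series (fun n => `|coefs f n| ^+ 2)).
Proof.
move=> s2 [Hf ef]; have [sf pf] := H2_coefs Hf.
rewrite -(cvg_lim _ (cvgM (cvg_cst s) (H2_form_cvg sf pf sf pf)))//.
rewrite -(cvg_lim _ (cvgM (cvg_cst (2 : R)) (square_summable_cvg sf)))//.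
congr (limn _); apply/funext => N; rewrite /series /GRing.mul /= !mulr_sumr.
apply: eq_bigr => n _; rewrite -ht_form_J ef.
by rewrite [in RHS]ht_formC ht_formZl.
Qed.

Lemma series_sqr_le_lim alpha N : square_summable alpha ->
  series (fun n => `|alpha n| ^+ 2) N <= limn (series (fun n => `|alpha n| ^+ 2)).
Proof.
move=> /square_summable_cvg sc; apply: nondecreasing_cvgn_le sc _.
by apply: nondecreasing_series => n _ _; exact: sqr_ge0.
Qed.

Lemma sqr_le_series alpha n : `|alpha n| ^+ 2 <= series (fun n => `|alpha n| ^+ 2) n.+1.
Proof.
by rewrite /series /= big_nat_recr//= lerDr sumr_ge0// => k _; exact: sqr_ge0.
Qed.

(** The classical completeness argument for square-summable sequences: take limits coefficientwise,
    then check that the limit is square summable, lies in the eigenspace and is a limit in norm. *)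
Lemma H2_eig_complete s : s * s = 1 ->
  complete_on (H2_eig s) (fun f g => s * H2_form f g).
Proof.
move=> s2 u Vu cu; have Hu n : H2 (u n) := (Vu n).1.
have cauchyB (e : R) : 0 < e -> exists N, forall m n K, (N <= m)%N -> (N <= n)%N ->
    2 * series (fun k => `|coefs (u m) k - coefs (u n) k| ^+ 2) K <= e ^+ 2.
  move=> e_gt0; have [N uN] := cu e e_gt0; exists N => m n K Nm Nn.
  have := uN m n Nm Nn.
  have umn := H2_eig_B (Vu m) (Vu n).
  have [scf _] := H2_coefs umn.1.
  rewrite (H2_eig_form s2 umn) coefsB// in scf *; set L := limn _ => Le.
  have sL : series (fun k => `|coefs (u m) k - coefs (u n) k| ^+ 2) K <= L.
    exact: series_sqr_le_lim.
  have L_ge0 : 0 <= L.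
    by apply: le_trans sL; rewrite /series /= sumr_ge0// => k _; exact: sqr_ge0.
  apply: (@le_trans _ _ (2 * L)); first by rewrite ler_pM2l.
  have L2_ge0 : 0 <= 2 * L by rewrite mulr_ge0.
  by rewrite -(sqr_sqrtr L2_ge0) ler_sqr ?nnegrE ?sqrtr_ge0 ?ltW.
pose a k := limn (fun n => coefs (u n) k).
have ua k : coefs (u n) k @[n --> \oo] --> a k.
  apply: cauchy_cvg; apply: cauchy_exP => e e_gt0.
  have [N uN] := cauchyB e e_gt0; exists (coefs (u N) k).
  exists N => // n Nn; rewrite /= -ball_normE /=.
  have := sqr_le_series (fun k => coefs (u N) k - coefs (u n) k) k.
  have := uN N n k.+1 (leqnn N) Nn; set S := series _ _.
  have := normr_ge0 (coefs (u N) k - coefs (u n) k); set x := `|_| => x_ge0 Se xS.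
  rewrite ltNge; apply/negP => ex; nra.
(* For fixed [K] the sum is finite, so [n] may tend to infinity term by term; [N] does not depend on
   [K]. *)
have boundB (e : R) : 0 < e -> exists N, forall m K, (N <= m)%N ->
    2 * series (fun k => `|coefs (u m) k - a k| ^+ 2) K <= e ^+ 2.
  move=> e_gt0; have [N uN] := cauchyB e e_gt0; exists N => m K Nm.
  suff cK : 2 * series (fun k => `|coefs (u m) k - coefs (u n) k| ^+ 2) K
      @[n --> \oo] --> 2 * series (fun k => `|coefs (u m) k - a k| ^+ 2) K.
    by apply: cvgr_to_le cK _; exists N => // n Nn; exact: uN.
  apply: cvgM; first exact: cvg_cst.
  rewrite /series /=; elim: K => [|K ih].
    rewrite big_geq//; under eq_fun do rewrite big_geq//; exact: cvg_cst.
  rewrite big_nat_recr//=; under eq_fun do rewrite big_nat_recr//=.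
  apply: cvgD ih _; rewrite expr2; under eq_fun do rewrite expr2.
  by apply: cvgM; apply: cvg_norm; apply: cvgB (ua K); exact: cvg_cst.
have Ja k : ht_J (a k) = s *: a k.
  have Jl := @ht_J_linear R t t0.
  have := cvg_comp _ _ (ua k) (@ht_linear_continuous _ _ t0 _ _ Jl (a k)).
  rewrite (_ : _ \o _ = fun n => s *: coefs (u n) k); last first.
    by apply/funext => n /=; exact: (Vu n).2.
  move=> h1; apply: cvg_unique h1 _ => //.
  by apply: cvgZ (ua k); exact: cvg_cst.
(* [a] is the difference of the coefficients of [u N] and of [u N - a], both square summable. *)
have sa : square_summable a.
  have [N uN] := boundB 1 ltr01.
  have sd : square_summable (fun k => coefs (u N) k - a k).
    apply/square_summableP; exists (1 ^+ 2) => K.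
    apply: le_trans (uN N K (leqnn N)); rewrite ler_peMl ?ler1n//.
    by rewrite /series /= sumr_ge0// => k _; exact: sqr_ge0.
  have [sN _] := H2_coefs (Hu N).
  have := square_summable_lin (-1) sd sN.
  by congr square_summable; apply/funext => k; rewrite scaleN1r opprB subrK.
have [f pf] := power_series_ex sa.
have Hf : H2 f by exists a.
have fa : coefs f = a by exact: coefsE.
have Vf : H2_eig s f by split=> // n; rewrite fa.
exists f => //; apply/cvgrPdist_le => e e_gt0.
have [N uN] := boundB e e_gt0; exists N => // n Nn.
have [sd _] := H2_coefs (H2B (Hu n) Hf).
rewrite /= sub0r normrN ger0_norm ?sqrtr_ge0//.
rewrite -(ger0_norm (ltW e_gt0)) -sqrtr_sqr ler_wsqrtr//.
rewrite (H2_eig_form s2 (H2_eig_B (Vu n) Vf)) coefsB// fa in sd *.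
rewrite -ler_pdivlMl//; apply: limr_le; first exact: square_summable_cvg.
by apply: nearW => K; rewrite ler_pdivlMl//; exact: uN.
Qed.

Lemma H2_eig_hilbert s : s * s = 1 ->
  is_hilbert (H2_eig s) (fun f g => s * H2_form f g).
Proof.
move=> s2; split.
- exact: H2_eig_subspace.
- split=> [u v _ _|r u v w [Hu _] [Hv _] [Hw _]]; first by rewrite H2_formC.
  by rewrite H2_form_linear// mulrDr mulrCA.
- move=> f Vf; have [Hf _] := Vf; have [sf _] := H2_coefs Hf => f_neq0.
  rewrite H2_eig_form// pmulr_rgt0// lt_neqAle eq_sym.
  have lim_ge n := le_trans (sqr_le_series (coefs f) n) (series_sqr_le_lim n.+1 sf).
  rewrite (le_trans (sqr_ge0 _) (lim_ge 0%N)) andbT.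
  apply: contra_neq f_neq0 => lim0; apply: coefs_eq0 => // n; apply/eqP.
  have := lim_ge n; rewrite lim0 => cn.
  have : `|coefs f n| ^+ 2 == 0 by rewrite eq_le cn sqr_ge0.
  by rewrite sqrf_eq0 normr_eq0.
- exact: H2_eig_complete.
Qed.

(** As [J] preserves the form, the pairing of coefficients from opposite eigenspaces equals its own
    negative. *)
Lemma H2_eig_orthogonal f g : H2_eig 1 f -> H2_eig (-1) g -> H2_form f g = 0.
Proof.
move=> [Hf ef] [Hg eg]; have [sf pf] := H2_coefs Hf; have [sg pg] := H2_coefs Hg.
rewrite /H2_form (_ : series _ = fun=> 0); first exact: lim_cst.
apply/funext => N; rewrite /series /= big1// => n _.
have := ht_form_JJ (coefs g n) (coefs f n); rewrite ef eg scale1r.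
by rewrite ht_formZl; lra.
Qed.

Lemma H2_krein : is_krein (@H2 R t t0) (@H2_form R t t0).
Proof.
split; first by split=> [|r u v]; [exact: H2_0|exact: H2_lin].
  exact: H2_sym_bilinear.
exists (H2_eig 1), (H2_eig (-1)); split.
- apply/seteqP; split=> [f Hf|_ [f [Hf _]] [g [Hg _]] <-]; last first.
    by rewrite -[f]scale1r; exact: H2_lin.
  have [sf pf] := H2_coefs Hf; set a := coefs f in sf pf.
  (* [(1 + J) / 2] is the projection onto the +1 eigenspace; the remainder [a - b] then satisfies
     [J (a - b) = J a - b = b - a]. *)
  pose b n := 2^-1 *: (ht_J (a n) + a n).
  have sb : square_summable b.
    have := square_summable_linear (@ht_J_linear R t t0) sf.
    move=> /(square_summable_lin 1)/(_ sf).
    move=> /(square_summable_lin 2^-1)/(_ (square_summable0 t0)).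
    by congr square_summable; apply/funext => n; rewrite /= addr0 scale1r.
  have [g pg] := power_series_ex sb.
  have Hg : H2 g by exists b.
  have Jb n : ht_J (b n) = b n.
    by rewrite /b linearZ linearD /= ht_JK addrC.
  exists g; first by split=> // n; rewrite (coefsE sb pg) Jb scale1r.
  exists (f - g); last by rewrite addrC subrK.
  split=> [|n]; first exact: H2B.
  rewrite coefsB// (coefsE sb pg) -/a linearB /= Jb scaleN1r opprB.
  have b2 : b n + b n = ht_J (a n) + a n.
    by rewrite /b -scalerDl (_ : 2^-1 + 2^-1 = 1 :> R) ?scale1r//; field.
  by rewrite -[ht_J (a n)](addrK (a n)) -b2 addrAC addrK.
- apply/seteqP; split=> [f [[Hf e1] [_ e2]]|_ ->]; last first.
    by split; exact: (H2_eig_subspace _).1.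
  (* A coefficient in both eigenspaces equals its own negative, hence is 0. *)
  apply: coefs_eq0 => // n; have := e1 n; rewrite e2 scale1r scaleN1r => /eqP.
  rewrite -subr_eq0 -opprD oppr_eq0 -mulr2n -scaler_nat scaler_eq0.
  by rewrite pnatr_eq0 => /eqP.
- exact: H2_eig_orthogonal.
- have := H2_eig_hilbert (mulr1 (1 : R)); congr is_hilbert.
  by apply/funext => u; apply/funext => v; rewrite mul1r.
- have := @H2_eig_hilbert (-1); rewrite mulrNN mulr1 => /(_ erefl).
  congr is_hilbert; apply/funext => u; apply/funext => v.
  by rewrite mulN1r.
Qed.

(** * Right module structure and reproducing kernel *)

Lemma H2_right_module : is_right_module (@H2 R t t0) (@H2_act R t t0).
Proof.
have HD f g : H2 f -> H2 g -> H2 (f + g).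
  by move=> Hf Hg; rewrite -[f]scale1r; exact: H2_lin.
split.
- exact: H2_0.
- exact: H2B.
- by move=> u c; exact: H2_act_mem.
- move=> u v c Hu Hv; rewrite !H2_actE//; last exact: HD.
  by apply/funext => q; exact: mulrDl.
- by move=> u c d Hu; rewrite !H2_actE//; apply/funext => q; exact: mulrDr.
- move=> u c d Hu; rewrite (H2_actE d (H2_act_mem c Hu)) !H2_actE//.
  by apply/funext => q; exact: mulrA.
- by move=> u Hu; rewrite H2_actE//; apply/funext => q; exact: mulr1.
Qed.

Lemma square_summable_star_exp p :
  square_summable (fun n => ht_star (sval p ^+ n)).
Proof.
have [K K_gt0 pK] := ht_exp_bound (sval p); set r := opnorm _ in pK.
have r_ge0 : 0 <= r by exact: opnorm_ge0.
have r1 : r < 1 by exact: (svalP p).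
have r2 : r ^+ 2 < 1 by rewrite expr_lt1.
pose C := (K * `|1 : H|) ^+ 2.
have C_ge0 : 0 <= C by exact: sqr_ge0.
(* [ht_star] preserves the Euclidean norm, so the squared norms are dominated by the geometric
   series of ratio [r^2], whose sum is this bound. *)
apply/square_summableP; exists (C / (1 - r ^+ 2)) => N.
apply: (@le_trans _ _ (series (geometric C (r ^+ 2)) N)).
  apply: ler_sum => n _; rewrite ht_star_norm /geometric /= /C.
  rewrite -exprM mulnC exprM -exprMn ler_sqr ?nnegrE//.
    by rewrite mulrAC; have := pK n 1; rewrite mulr1.
  by rewrite !mulr_ge0 ?exprn_ge0// ltW.
rewrite geometric_seriesE ?lt_eqF//= ler_pM2r ?invr_gt0 ?subr_gt0//.
by rewrite ler_piMr// gerBl exprn_ge0// sqr_ge0.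
Qed.

Lemma H2_kernel_power_series p :
  power_series_of (fun n => ht_star (sval p ^+ n)) (fun q => H2_kernel q p).
Proof. by move=> q; exact: power_series_cvg (square_summable_star_exp p). Qed.

Lemma H2_kernel_reproducing :
  is_reproducing_kernel (@H2 R t t0) (@H2_form R t t0) (@H2_kernel R t t0).
Proof.
move=> p b.
have sk : square_summable (fun n => ht_star (sval p ^+ n) * b).
  exact: square_summable_linear (ht_mulr_linear b) (square_summable_star_exp p).
have pk := power_series_mulr (c := b) (@H2_kernel_power_series p).
split=> [|f Hf]; first by eexists; [exact: sk|exact: pk].
have [sf pf] := H2_coefs Hf.
have h1 := H2_form_cvg sf pf sk pk.
have fl : linear (fun c : H => ht_form c b : R^o) by exact: ht_form_linear.
pose F : {linear H -> R^o} :=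
  HB.pack (fun c : H => ht_form c b : R^o) (GRing.isLinear.Build _ _ _ _ _ fl).
(* Adjunction moves [p^n] onto the coefficient of [f], so each partial sum of the form is [F] of a
   partial sum of [f p]; continuity of [F] then identifies the limits. *)
have S N : series (fun n => ht_form (ht_star (sval p ^+ n) * b) (coefs f n)) N =
    F (series (fun n => sval p ^+ n * coefs f n) N).
  rewrite /series linear_sum; apply: eq_bigr => n _.
  by rewrite ht_formC ht_form_starM.
apply: cvg_unique h1 _ => //; rewrite (funext S).
exact: (cvg_comp _ _ (pf p) (@ht_linear_continuous _ _ t0 _ _ fl (f p))).
Qed.

End Krein.

(* The first four clauses say that the series in the definitions of the space,
   the form, the right action and the kernel converge, and that the form and
   the action are given by the stated formulas on coefficients; the last three
   are the claims about the space. *)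
Theorem proposition5p2 (R : realType) (t : R) (t0 : t != 0) :
  [/\ (forall alpha : nat -> Ht t0, square_summable alpha ->
         exists f, power_series_of alpha f),
      (forall (f g : Omega t0 -> Ht t0) (fn gn : nat -> Ht t0),
         square_summable fn -> power_series_of fn f ->
         square_summable gn -> power_series_of gn g ->
         series (fun n => ht_form (gn n) (fn n)) @ \oo --> H2_form f g),
      (forall (f : Omega t0 -> Ht t0) (fn : nat -> Ht t0) (c : Ht t0),
         square_summable fn -> power_series_of fn f ->
         power_series_of (fun n => fn n * c) (H2_act f c)) &
      (forall q p : Omega t0,
         series (fun n => sval q ^+ n * ht_star (sval p ^+ n)) @ \oo -->
           H2_kernel q p)] /\
  [/\ is_krein (@H2 R t t0) (@H2_form R t t0),
      is_right_module (@H2 R t t0) (@H2_act R t t0) &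
      is_reproducing_kernel (@H2 R t t0) (@H2_form R t t0)
        (@H2_kernel R t t0)].
Proof.
split; split.
- exact: power_series_ex.
- exact: H2_form_cvg.
- move=> f fn c sf pf; rewrite H2_actE; last by exists fn.
  exact: power_series_mulr.
- by move=> q p; exact: H2_kernel_power_series.
- exact: H2_krein.
- exact: H2_right_module.
- exact: H2_kernel_reproducing.
Qed.
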